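(* For every integer $n\ge 1$, the following identities hold. (i) $$\sum_{\sigma\in B_n}(-1)^{\lfloor \mathrm{fwex}(\sigma)/2\rfloor}\, t^{\mathrm{neg}(\sigma)}q^{\mathrm{cro}_B(\sigma)}=\left[(-1)^{\lfloor\frac{n+1}{2}\rfloor}+(-1)^{\lfloor\frac{n}{2}\rfloor}\, t \right] R_{n-1}(t,q).$$ (ii) $$\sum_{\sigma\in D_n}(-1)^{\lfloor \mathrm{fwex}(\sigma)/2\rfloor}\, t^{\mathrm{neg}(\sigma)}q^{\mathrm{cro}_B(\sigma)}=\begin{cases}(-1)^{\frac n2}\,t\,R_{n-1}(t,q) & \text{if } n \text{ is even},\\ (-1)^{\frac{n+1}{2}}R_{n-1}(t,q) & \text{if } n \text{ is odd}.\end{cases}$$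
   Context: Let $[n]=\{1,\dots,n\}$. A signed permutation of $[n]$ is a bijection $\sigma$ of $\{-n,\dots,-1,1,\dots,n\}$ onto itself with $\sigma(-i)=-\sigma(i)$ for all $i$; it is written $\sigma=\sigma_1\sigma_2\cdots\sigma_n$ with $\sigma_i=\sigma(i)$. $B_n$ is the set of signed permutations of $[n]$, and $D_n\subset B_n$ is the subset of those with an even number of negative entries among $\sigma_1,\dots,\sigma_n$. For $\sigma\in B_n$: $\mathrm{neg}(\sigma)=\#\{i\in[n]:\sigma_i<0\}$, $\mathrm{wex}(\sigma)=\#\{i\in[n]:\sigma_i\ge i\}$, and $\mathrm{fwex}(\sigma)=2\,\mathrm{wex}(\sigma)+\mathrm{neg}(\sigma)$. A crossing of $\sigma$ is a pair $(i,j)$ with $i,j\in[n]$ such that $i<j\le\sigma_i<\sigma_j$, or $-i<j\le-\sigma_i<\sigma_j$, or $i>j>\sigma_i>\sigma_j$; $\mathrm{cro}_B(\sigma)$ is the number of crossings of $\sigma$. Let $D$ be the $q$-derivative acting on polynomials in $t$, $(Df)(t)=\frac{f(qt)-f(t)}{(q-1)t}$ (so $D(t^m)=[m]_q t^{m-1}$ with $[m]_q=1+q+\cdots+q^{m-1}$, $[0]_q=0$), and let $U$ be multiplication by $t$. Define $R_n(t,q)=(D+DUU)^n\,1$ for $n\ge 0$ (products of operators are compositions, the rightmost applied first). *)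

(* Defs.v *)
From HB Require Import structures.
From mathcomp Require Import all_boot all_order all_fingroup all_algebra.

Set Implicit Arguments.
Unset Strict Implicit.
Unset Printing Implicit Defensive.

Import Order.TTheory GRing.Theory Num.Theory.

Local Open Scope ring_scope.

(* The set {-n, ..., -1, 1, ..., n}: (i, false) stands for i + 1 and
   (i, true) for -(i + 1). *)
Notation letter n := ('I_n * bool)%type.

Definition letter_val (n : nat) (x : letter n) : int :=
  if x.2 then - x.1.+1%:Z else x.1.+1%:Z.

Definition letter_opp (n : nat) (x : letter n) : letter n := (x.1, ~~ x.2).

Lemma letter_val_inj (n : nat) : injective (@letter_val n).
Proof.
case=> [i b] [j c]; rewrite /letter_val /=; case: b; case: c => //.
- by move/oppr_inj=> [] /val_inj ->.
- by case=> /val_inj ->.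
Qed.

Lemma letter_val_opp (n : nat) (x : letter n) :
  letter_val (letter_opp x) = - letter_val x.
Proof. by case: x => [i []]; rewrite /letter_val //= opprK. Qed.

Definition signed_perms (n : nat) : {set {perm letter n}} :=
  [set s : {perm letter n} | [forall x, s (letter_opp x) == letter_opp (s x)]].

(* The position i : 'I_n stands for the integer i + 1 of [n]. *)
Definition position (n : nat) (i : 'I_n) : int := letter_val (i, false).

Definition window (n : nat) (s : {perm letter n}) (i : 'I_n) : int :=
  letter_val (s (i, false)).

Definition neg (n : nat) (s : {perm letter n}) : nat :=
  #|[set i : 'I_n | window s i < 0]|.

Definition wex (n : nat) (s : {perm letter n}) : nat :=
  #|[set i : 'I_n | position i <= window s i]|.

Definition fwex (n : nat) (s : {perm letter n}) : nat := (2 * wex s + neg s)%N.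

Definition crossing (n : nat) (s : {perm letter n}) (i j : 'I_n) : bool :=
  [|| [&& position i < position j, position j <= window s i & window s i < window s j],
      [&& - position i < position j, position j <= - window s i & - window s i < window s j]
    | [&& position j < position i, window s i < position j & window s j < window s i]].

Definition croB (n : nat) (s : {perm letter n}) : nat :=
  #|[set p : 'I_n * 'I_n | crossing s p.1 p.2]|.

Definition even_signed_perms (n : nat) : {set {perm letter n}} :=
  [set s in signed_perms n | ~~ odd (neg s)].

(* Polynomials in t and q over the integers are represented as polynomials
   in t whose coefficients are polynomials in q. *)
Notation tq_poly := {poly {poly int}}.

Definition t : tq_poly := 'X.
Definition q : tq_poly := 'X%:P.

Definition qint (m : nat) : {poly int} := \sum_(k < m) 'X^k.

(* The q-derivative, given on the monomials by D(t^m) = [m]_q t^(m-1).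
   Lemma qderivE says that it is the exact quotient of f(qt) - f(t) by
   (q - 1)t, which determines it as tq_poly is an integral domain. *)
Definition qderiv (f : tq_poly) : tq_poly :=
  \poly_(m < (size f).-1) (qint m.+1 * f`_m.+1).

Lemma qderivE (f : tq_poly) : (q - 1) * t * qderiv f = f \Po (q * t) - f.
Proof.
have qm1 m : ('X - 1) * qint m = 'X^m - 1 by rewrite /qint -subrX1.
have -> : f \Po (q * t) = \poly_(m < size f) ('X^m * f`_m).
  rewrite comp_polyE poly_def; apply: eq_bigr => m _.
  rewrite exprMn /q /t -polyC_exp -[RHS]mul_polyC -[LHS]mul_polyC polyCM.
  by rewrite mulrA [_ * ('X^m)%:P]mulrC.
apply/polyP=> m; rewrite /q /t -[1 : tq_poly]/(1%:P) -polyCB -mulrA.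
rewrite coefCM coefXM coefB !coef_poly.
case: m => [|m] /=.
  by rewrite mulr0; case: ltnP => [_|/leq_sizeP ->//]; rewrite ?expr0 ?mul1r subrr.
rewrite ltn_predRL; case: ltnP => [_|/leq_sizeP -> //].
  by rewrite mulrA qm1 mulrBl mul1r.
by rewrite mulr0 subr0.
Qed.

Lemma qderivXn (m : nat) : qderiv (t ^+ m) = (qint m)%:P * t ^+ m.-1.
Proof.
rewrite /qderiv /t size_polyXn /=; apply/polyP=> k.
rewrite coef_poly coefCM !coefXn.
case: m => [|m] /=; first by rewrite /qint big_ord0 mul0r.
rewrite eqSS; case: eqP => [->|_]; first by rewrite ltnSn.
by rewrite !mulr0 if_same.
Qed.

Definition mult (f : tq_poly) : tq_poly := t * f.

Definition Rpoly (n : nat) : tq_poly :=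
  iter n (fun f => qderiv f + qderiv (mult (mult f))) 1.

(* Main.v *)
Require Import Defs.
From HB Require Import structures.
From mathcomp Require Import all_boot all_order all_fingroup all_algebra.
From mathcomp Require Import zify ring.

Import Order.TTheory GRing.Theory Num.Theory.

Local Open Scope ring_scope.

(** Why the theorem holds. Forget the signs for a moment and keep, of a signed
    permutation s, only the positive letters: what remains is a partial
    injection f from positions to values, with h = neg s positions and h values
    left open. The number of weak excedances depends on f alone. A crossing
    that involves a positive letter also depends on f alone, since a negative
    letter crosses a weak excedance when its absolute value lies under the arc,
    and another positive letter when its position does, whatever its other end
    is. The crossings between two negative letters are the inversions of the
    bijection from open positions to open values, so the completions of f
    contribute the q-factorial [h]! ([sum_Xn_inv_on]). Hence the signed sum is a
    sum over partial injections weighted by [h]! x^wex q^cro t^h, with x = -1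
    ([sum_signed_weight]).

    Partial injections on n + 1 letters are built from those on n letters by
    inserting a new smallest position and a new smallest value. The new
    position either stays open, or is sent to the new value, or closes an open
    value; the new value either stays open or closes an open position. Closing
    a letter creates as many crossings as there are smaller letters that could
    have been closed instead, which turns a choice among k letters into the
    factor [k]. Because of the factor [h]! the whole step becomes a
    q-differential operator, f |-> (t + x) D ((t + 1) f) ([pinj_sumS]).

    For x = -1 the factors (t - 1) and (t + 1) of consecutive steps meet inside
    D and give D (t^2 - 1), so that the sum for n >= 1 is (t - 1) applied to
    (D t^2 - D)^(n-1) 1 ([pinj_sum_altRpoly]). Replacing t by a square root of
    -1 times t transforms D t^2 - D into a multiple of D t^2 + D. Over the
    integers this substitution reads as a sign on each coefficient, fixed by
    the parity of the degrees that occur ([coef_altRpoly]). The sign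
    (-1)^floor(neg/2) left over in fwex is the trace of the same substitution,
    and the two signs cancel up to the global one of the theorem. Even signed
    permutations correspond to the even powers of t. *)

(** * Inversions and q-factorials *)

(** The ranks of the elements of [V] are 0, 1, ..., #|V| - 1, once each. This is
    the source of all the q-integers below. *)
Lemma sum_Xn_rank {n} (V : {set 'I_n}) :
  \sum_(v in V) 'X^(#|[set u in V | (u < v)%N]|) = qint #|V|.
Proof.
have [m] := ubnP #|V|; elim: m V => // m IHm V leVm.
have [->|[v0 v0V]] := set_0Vmem V; first by rewrite big_set0 cards0 /qint big_ord0.
case: (arg_maxnP (fun v : 'I_n => v : nat) v0V) => w; rewrite -[_ w]/(w \in V) => wV maxw.
  have {}maxw u : u \in V -> (u <= w)%N := maxw u.
rewrite (big_setD1 w) //= (cardsD1 w V) wV /qint add1n big_ord_recr /= addrC.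
congr (_ + 'X^_).
- rewrite -[RHS]IHm; last by move: leVm; rewrite (cardsD1 w V) wV add1n ltnS.
  apply: eq_bigr => v; rewrite !inE => /andP[vw vV]; congr 'X^(_).
  apply: eq_card => u; rewrite !inE; case: eqP => //= ->; rewrite wV /=.
  by apply/negbTE; rewrite -leqNgt; exact: maxw.
- apply: eq_card => u; rewrite !inE andbC; case uV: (u \in V); rewrite ?andbF //= !andbT.
  by rewrite ltn_neqAle (maxw u uV) andbT.
Qed.

Definition qfact (h : nat) : {poly int} := \prod_(k < h) qint k.+1.

Lemma qfactS h : qfact h.+1 = qfact h * qint h.+1.
Proof. by rewrite /qfact big_ord_recr. Qed.

Definition inv_on {n} (P : {set 'I_n}) (p : 'S_n) : nat :=
  #|[set x : 'I_n * 'I_n |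
      [&& x.1 \in P, x.2 \in P, (x.2 < x.1)%N & (p x.1 < p x.2)%N]]|.

(** The completions of an injective [g] given off [P] are counted by inversions on
    [P] as if [P] were an interval: the image of the least position of [P] may be
    any of the #|P| unused values, and it is inverted with every smaller one. *)
Lemma sum_Xn_inv_on {n} (P : {set 'I_n}) (g : 'I_n -> 'I_n) :
  {in ~: P &, injective g} ->
  \sum_(p : 'S_n | [forall i in ~: P, p i == g i]) 'X^(inv_on P p) = qfact #|P|.
Proof.
have [m] := ubnP #|P|; elim: m P g => // m IHm P g lePm g_inj.
have [P0|[i0 i0P]] := set_0Vmem P.
  have gi : injective g by move=> i j; apply: g_inj; rewrite P0 !inE.
  rewrite P0 cards0 /qfact big_ord0 (big_pred1 (perm gi)) => [|p].
    rewrite /inv_on (_ : [set _ | _] = set0) ?cards0 //.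
    by apply/setP=> x; rewrite !inE.
  apply/forallP/eqP=> [pg|-> i]; last by rewrite permE eqxx implybT.
  by apply/permP=> i; rewrite permE; apply/eqP; move: (pg i); rewrite !inE.
case: (arg_minnP (fun i : 'I_n => i : nat) i0P) => w; rewrite -[_ w]/(w \in P) => wP minw.
  have {}minw u : u \in P -> (w <= u)%N := minw u.
(* V is the set of unused values: every completion maps P onto it. *)
pose V := ~: (g @: ~: P).
have cardV : #|V| = #|P|.
  by rewrite [LHS]cardsCs [RHS]cardsCs card_ord -(card_in_imset g_inj) setCK.
have PE (p : 'S_n) : [forall i in ~: P, p i == g i] -> p @: P = V.
  move=> /forall_inP pg; rewrite /V.
  rewrite (_ : [set g x | x in ~: P] = p @: ~: P).
    by apply/setP=> v; rewrite inE -(permKV p v) !(mem_imset _ _ perm_inj) inE negbK.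
  by apply/esym/eq_in_imset => i /pg /eqP.
rewrite (partition_big (fun p : 'S_n => p w) (mem V)) /= => [|p /PE <-]; last first.
  by rewrite (mem_imset _ _ perm_inj).
rewrite (cardsD1 w) wP add1n qfactS mulrC.
have <- : #|V| = #|P :\ w|.+1 by rewrite cardV (cardsD1 w P) wP.
rewrite -sum_Xn_rank mulr_suml; apply: eq_bigr => v vV.
pose g' i := if i == w then v else g i.
have CPw i : i \in ~: (P :\ w) -> i = w \/ i != w /\ i \in ~: P.
  by rewrite !inE negb_and negbK; case: eqP => [|_ /=]; [left | right].
rewrite -(IHm (P :\ w) g').
- rewrite mulr_sumr; apply: eq_big => [p|p /=/andP[pg /eqP pw]].
    apply/andP/forall_inP=> [[/forall_inP pg /eqP pw] i|pg].
      by rewrite /g'; case/CPw => [->|[/negbTE-> /pg]] //; rewrite eqxx pw.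
    split; last by have := pg w; rewrite /g' eqxx !inE eqxx => ->.
    apply/forall_inP=> i iP; have := pg i; rewrite /g' in_setC in_setD1.
    move: iP; rewrite inE; case: (i =P w) => [->|_ iP]; first by rewrite wP.
    by apply.
  (* The inversions that involve the least position w of P are separated from
     the others; they correspond to the unused values below v = p w. *)
  rewrite -exprD; congr 'X^_; rewrite /inv_on.
  rewrite -(cardsID [set x : 'I_n * 'I_n | x.2 == w]); congr (_ + _)%N.
    have inj : injective (fun u : 'I_n => ((p^-1)%g u, w)) by move=> u u' [/perm_inj].
    rewrite -(card_imset _ inj); apply: eq_card => -[i j]; rewrite !inE /=.
    apply/andP/imsetP => [[/and4P[iP jP ji pij] /eqP jw]|[u]].
      exists (p i); last by rewrite permK jw.
      by rewrite inE -pw -jw pij -(PE p pg) (mem_imset _ _ perm_inj) iP.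
    rewrite inE -(PE p pg) => /andP[/imsetP[k kP ->] pkv] [-> ->].
    rewrite permK kP wP pw pkv eqxx andbT; split=> //=.
    rewrite ltn_neqAle minw // andbT; apply: contraTneq pkv => /val_inj <-.
    by rewrite pw ltnn.
  apply: eq_card => -[i j]; rewrite !inE /=.
  case: (j =P w) => [->|jw] /=; first by rewrite !andbF.
  case: (i =P w) => [->|iw] //=; case jP : (j \in P); rewrite ?andbF //=.
  by rewrite ltnNge minw // andbF.
- by move: lePm; rewrite (cardsD1 w P) wP add1n ltnS.
- move=> i j /CPw iP /CPw jP; rewrite /g'.
  have gV k : k \in ~: P -> g k != v.
    by move=> kP; apply: contraTneq vV => <-; rewrite inE negbK imset_f.
  case: iP jP => [->|[/negbTE iw iP]] [->|[/negbTE jw jP]] //; rewrite ?eqxx ?iw ?jw.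
  + by move=> /esym/eqP; rewrite (negbTE (gV j jP)).
  + by move=> /eqP; rewrite (negbTE (gV i iP)).
  + exact: g_inj.
Qed.

(** * Partial injections *)

Notation partial_map n := {ffun 'I_n -> option 'I_n}.

Definition pinj {n} (f : partial_map n) : bool :=
  [forall i, forall j, (f i != None) && (f i == f j) ==> (i == j)].

Lemma pinjP {n} (f : partial_map n) :
  reflect (forall i j v, f i = Some v -> f j = Some v -> i = j) (pinj f).
Proof.
apply: (iffP forallP) => [fP i j v fi fj|fP i].
  by apply/eqP; move/forallP: (fP i) => /(_ j); rewrite fi fj eqxx.
apply/forallP=> j; case fi: (f i) => [v|] //=.
by apply/implyP=> /eqP/esym fj; apply/eqP; exact: fP fi fj.
Qed.

Definition open_pos {n} (f : partial_map n) : {set 'I_n} := [set i | f i == None].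
Definition open_val {n} (f : partial_map n) : {set 'I_n} :=
  [set v | [forall i, f i != Some v]].

Lemma open_valP {n} (f : partial_map n) v :
  reflect (forall i, f i <> Some v) (v \in open_val f).
Proof. by rewrite inE; apply: (iffP forallP) => fP i; apply/eqP/fP. Qed.

Lemma card_open_val {n} (f : partial_map n) : pinj f -> #|open_val f| = #|open_pos f|.
Proof.
move/pinjP=> f_inj; rewrite [LHS]cardsCs [RHS]cardsCs; congr (_ - _)%N.
rewrite -(card_imset _ (@Some_inj _)) -[RHS](card_in_imset (f := f)).
  apply: eq_card => o; apply/imsetP/imsetP => -[].
    move=> v; rewrite !inE => /forallPn[i]; rewrite negbK => /eqP fi ->.
    by exists i; rewrite ?fi // !inE fi.
  move=> i; rewrite !inE; case fi: (f i) => [v|//] _ ->.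
  by exists v; rewrite // !inE; apply/forallPn; exists i; rewrite fi negbK.
move=> i j; rewrite !inE; case fi: (f i) => [v|//] _ _ /esym fj; exact: f_inj fi fj.
Qed.

Definition weak_exc {n} (f : partial_map n) : nat :=
  \sum_(i < n) (if f i is Some v then (i <= v)%N else false).

(** Crossings seen from the positive weak excedance j -> f j: for j <= u < f j, the
    letter whose value has absolute value u crosses it, unless it is positive and
    starts at the right of j. An open u is hit by a negative letter, whose mirror image starts at the
    left of every position, so it always counts. *)
Definition upper {n} (f : partial_map n) (j u : 'I_n) : bool :=
  if f j is Some v then
    (j <= u < v)%N && [forall i : 'I_n, (j < i)%N ==> (f i != Some u)]
  else false.

(** Crossings seen from the positive anti-excedance i -> f i. An open position j
    holds a negative letter, which goes below every positive value, so it counts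
    as soon as it lies under the arc. *)
Definition lower {n} (f : partial_map n) (i j : 'I_n) : bool :=
  if f i is Some v then
    (v < j < i)%N && (if f j is Some w then (w < v)%N else true)
  else false.

Definition cro_partial {n} (f : partial_map n) : nat :=
  (\sum_(j < n) \sum_(u < n) upper f j u + \sum_(i < n) \sum_(j < n) lower f i j)%N.

(** * Inserting a smallest position and a smallest value *)

(** The old positions and values are shifted by one, [a] is the image of the new
    position, and [b] is the old position sent to the new value, if any. The case
    where the new position is sent to the new value is [a = Some ord0]. *)
Definition extend {n} (f : partial_map n) (a : option 'I_n.+1) (b : option 'I_n) :
    partial_map n.+1 :=
  [ffun i => if unlift ord0 i is Some i' then
     if b == Some i' then Some ord0 else omap (lift ord0) (f i') else a].

Lemma extend0 {n} (f : partial_map n) a b : extend f a b ord0 = a.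
Proof. by rewrite ffunE unlift_none. Qed.

Lemma extendS {n} (f : partial_map n) a b i :
  extend f a b (lift ord0 i) = if b == Some i then Some ord0 else omap (lift ord0) (f i).
Proof. by rewrite ffunE liftK. Qed.

(** The pairs [(a, b)] for which [extend f a b] is again an injection that gives back
    [f]: only open letters may be closed, and the new value is used at most once. *)
Definition extendable {n} (f : partial_map n) (a : option 'I_n.+1) (b : option 'I_n) :
    bool :=
  (if b is Some i then i \in open_pos f else true) &&
  (if a is Some v then
     if unlift ord0 v is Some v' then v' \in open_val f else b == None else true).

Definition restrict {n} (f : partial_map n.+1) :
    partial_map n * option 'I_n.+1 * option 'I_n :=
  ([ffun i => obind (unlift ord0) (f (lift ord0 i))], f ord0,
   [pick i | f (lift ord0 i) == Some ord0]).

Lemma lift0_neq n (i : 'I_n) : ord0 <> lift ord0 i.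
Proof. by move/eqP; rewrite (negbTE (neq_lift _ _)). Qed.

Lemma restrictK {n} (f : partial_map n.+1) : pinj f ->
  extend (restrict f).1.1 (restrict f).1.2 (restrict f).2 = f.
Proof.
move/pinjP=> f_inj; apply/ffunP=> i; rewrite /restrict /=.
case: (unliftP ord0 i) => [i'|] ->; rewrite ?extend0 // extendS ffunE.
case: pickP => [k /eqP fk|f0].
  case: eqP => [[<-]//|ki]; case fi: (f _) => [v|] //=.
  case: (unliftP ord0 v) fi => [v'|] -> // fi; case: ki; congr Some.
  by apply: (@lift_inj _ ord0); exact: f_inj fk fi.
case fi: (f _) => [v|] //=; case: (unliftP ord0 v) fi => [v'|] -> // fi.
by move: (f0 i'); rewrite fi eqxx.
Qed.

(** With [restrictK], this makes [extend] a bijection from extendable triples to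
    partial injections, in the form that reindexing a sum calls for. *)
Lemma pinj_extend {n} (f : partial_map n) a b :
  pinj (extend f a b) && (restrict (extend f a b) == (f, a, b))
  = pinj f && extendable f a b.
Proof.
apply/andP/andP => [[/pinjP F_inj /eqP[rf _ rb]]|[/pinjP f_inj /andP[Eb Ea]]].
  have fF i v : f i = Some v -> extend f a b (lift ord0 i) = Some (lift ord0 v).
    rewrite -{1}rf ffunE; case: (extend _ _ _ _) => [w|] //=.
    by case: (unliftP ord0 w) => [w' ->|//] [->].
  have bF i : b = Some i -> extend f a b (lift ord0 i) = Some ord0.
    by move=> ->; rewrite extendS eqxx.
  split; [|apply/andP; split].
  - apply/pinjP=> i j v /fF fi /fF fj; apply: (@lift_inj _ ord0); exact: F_inj fi fj.
  - case Eb: {1}b => [i|//]; rewrite inE -rf ffunE (bF i) //= unlift_none //.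
  - case Ea: {1}a => [v|//]; have a0 : extend f a b ord0 = Some v by rewrite extend0.
    case: (unliftP ord0 v) a0 => [v'|] -> a0; last first.
      by case Eb: {1}b => [i|//]; case: (@lift0_neq n i); apply: F_inj a0 (bF _ Eb).
    by apply/open_valP=> i /fF fi; case: (@lift0_neq n i); apply: F_inj a0 fi.
have Eb' i : b = Some i -> f i = None by move=> bi; move: Eb; rewrite bi inE => /eqP.
split; last first.
  rewrite /restrict extend0; apply/eqP; congr (_, _, _).
    apply/ffunP=> i; rewrite ffunE extendS; case: eqP => [/Eb' ->|_].
      by rewrite /= unlift_none.
    by case: (f i) => //= v; rewrite liftK.
  case: pickP => [i|f0].
    rewrite extendS; case: (b =P Some i) => [->//|_]; case: (f i) => //= v.
  by case Ebi: {1}b => [i|]; rewrite ?Ebi //; move: (f0 i); rewrite extendS Ebi !eqxx.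
have aS i v : a = Some v -> extend f a b (lift ord0 i) <> Some v.
  move=> av; move: Ea; rewrite av extendS; case: (unliftP ord0 v) => [v'|] ->.
    move=> /open_valP fv; case: eqP => [_ /Some_inj/lift0_neq//|_].
    by case fi: (f i) => [w|] //= /Some_inj/lift_inj Ew; case: (fv i); rewrite fi Ew.
  move=> /eqP ->; case: (f i) => //= w /Some_inj/esym/lift0_neq//.
apply/pinjP=> i j v; case: (unliftP ord0 i) => [i'|] ->; last first.
  rewrite extend0 => av; case: (unliftP ord0 j) => [j'|] -> //.
  by move/aS: av => /[apply].
case: (unliftP ord0 j) => [j'|] ->; last first.
  by move=> /[swap]; rewrite extend0 => av /(aS _ _ av).
rewrite !extendS; case: eqP => [bi|_] fi; case: eqP => [bj|_] fj //.
- by move: bi; rewrite bj => -[->].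
- by move: fj; rewrite -fi; case: (f j') => //= w /Some_inj/esym/lift0_neq.
- by move: fi; rewrite -fj; case: (f i') => //= w /Some_inj/esym/lift0_neq.
move: fi fj; case fi: (f i') => [w|] //= [<-]; case fj: (f j') => [w'|] //= /Some_inj/lift_inj Ew.
by congr (lift _ _); apply: f_inj fi _; rewrite fj Ew.
Qed.

Lemma big_option (R : nmodType) (T : finType) (P : pred (option T)) (F : option T -> R) :
  \sum_(o | P o) F o = (if P None then F None else 0) + \sum_(x | P (Some x)) F (Some x).
Proof.
rewrite (bigID (pred1 None)) /= big_mkcondl big_pred1_eq; congr (_ + _).
rewrite (reindex_omap Some id) /=; first by apply: eq_bigl => x; rewrite eqxx !andbT.
by case=> // /andP[].
Qed.

Lemma sum_nat_of_bool (T : finType) (P : pred T) : (\sum_(i : T) P i = #|[set i | P i]|)%N.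
Proof. by rewrite -big_mkcond sum1dep_card. Qed.

Lemma weak_exc_extend {n} (f : partial_map n) a b : extendable f a b ->
  weak_exc (extend f a b) = (weak_exc f + (a != None))%N.
Proof.
case/andP=> Eb _; rewrite /weak_exc big_ord_recl extend0 addnC; congr (_ + _)%N.
  apply: eq_bigr => i _; rewrite extendS; case: eqP Eb => [->|_].
    by rewrite inE => /eqP ->.
  by case: (f i).
by case: a.
Qed.

Lemma card_open_extend {n} (f : partial_map n) a b : extendable f a b ->
  (#|open_pos (extend f a b)| + (b != None) = #|open_pos f| + (a == None))%N.
Proof.
case/andP=> Eb _; rewrite /open_pos -!sum_nat_of_bool big_ord_recl extend0.
rewrite [RHS]addnC -addnA; congr (_ + _)%N.
case: b Eb => [k|] Eb; last first.
  by rewrite addn0; apply: eq_bigr => i _; rewrite extendS /=; case: (f i).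
rewrite (bigD1 k) //= [RHS](bigD1 k) //= extendS eqxx.
move: Eb; rewrite inE => ->; rewrite addnC add0n; congr (_ + _)%N.
apply: eq_bigr => i ik; rewrite extendS (inj_eq (@Some_inj _)) [k == i]eq_sym (negbTE ik).
by case: (f i).
Qed.

(** The crossings between old letters are unchanged, even when an open letter gets
    closed: it crossed the same arcs as a negative letter. The new position, when it
    closes a value v, is crossed by the open values below v, the new one included. *)
Lemma upper_extend {n} (f : partial_map n) a b : extendable f a b ->
  [/\ forall j u, upper (extend f a b) (lift ord0 j) (lift ord0 u) = upper f j u,
      forall j, upper (extend f a b) (lift ord0 j) ord0 = false,
      upper (extend f a b) ord0 ord0 = ((b == None) && (if a is Some v then 0 < v else false)%N) &
      forall u, upper (extend f a b) ord0 (lift ord0 u) =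
        (u \in open_val f) && (if a is Some v then lift ord0 u < v else false)%N].
Proof.
case/andP=> Eb Ea.
have FS i w : (extend f a b (lift ord0 i) == Some (lift ord0 w)) = (f i == Some w).
  rewrite extendS; case: (b =P Some i) Eb => [->|_ _].
    by rewrite inE => /eqP->; apply/eqP=> /Some_inj/lift0_neq.
  by case: (f i) => //= v; rewrite (inj_eq (@Some_inj _)) (inj_eq lift_inj).
have F0 i : (extend f a b (lift ord0 i) == Some ord0) = (b == Some i).
  rewrite extendS; case: (b =P Some i) => // _; case: (f i) => //= v.
split.
- move=> j u; rewrite /upper extendS; case: (b =P Some j) Eb => [->|_ _].
    by rewrite inE => /eqP ->; rewrite ltn0 andbF.
  case: (f j) => [v|] //=; rewrite /bump !leq0n !add1n !ltnS; congr (_ && _).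
  apply/forallP/forallP => fP i; last first.
    case: (unliftP ord0 i) => [i'|] -> //.
    by rewrite FS /= /bump !leq0n !add1n !ltnS.
  by have := fP (lift ord0 i); rewrite FS /= /bump !leq0n !add1n !ltnS.
- move=> j; rewrite /upper; case: (extend f a b (lift ord0 j)) => // v.
- rewrite /upper extend0; case: a {Ea FS} F0 => [v|] F0; last by rewrite andbF.
  rewrite andbC leq0n; congr (_ && _).
  case: b Eb F0 => [k|] Eb F0.
    by apply/negbTE/forallPn; exists (lift ord0 k); rewrite F0 eqxx.
  by apply/forallP=> i; case: (unliftP ord0 i) => [i'|] -> //; rewrite F0.
- move=> u; rewrite /upper extend0; case: a {Ea F0} FS => [v|] FS; last by rewrite andbF.
  rewrite andbC leq0n inE; congr (_ && _).
  apply/forallP/forallP => fP i.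
    by have := fP (lift ord0 i); rewrite FS.
  by case: (unliftP ord0 i) => [i'|] -> //; rewrite FS /= fP.
Qed.

(** The only new lower crossings are those of the arc ending at the new value: all
    open positions to the left of its start lie under it. *)
Lemma lower_extend {n} (f : partial_map n) a b : extendable f a b ->
  [/\ forall i j, lower (extend f a b) (lift ord0 i) (lift ord0 j) =
        lower f i j || [&& b == Some i, j \in open_pos f & (j < i)%N],
      forall i, lower (extend f a b) (lift ord0 i) ord0 = false &
      forall k, lower (extend f a b) ord0 k = false].
Proof.
case/andP=> Eb _; split.
- move=> i j; rewrite /lower !extendS.
  case: (b =P Some i) Eb => [->|_]; rewrite inE.
    move=> /eqP ->; rewrite /= /bump !leq0n !add1n !ltnS inE andbC /=.
    case: (i =P j) => [<-|ij]; first by rewrite ltnn !andbF.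
    by rewrite (inj_eq (@Some_inj _)) (introF eqP ij); case: (f j).
  rewrite orbF; case: b => [k|] => [|_].
    rewrite inE => /eqP fk; case: (f i) => [v|] //=.
    rewrite /bump !leq0n !add1n !ltnS; congr (_ && _).
    by case: (Some k =P Some j) => [[<-]|_]; [rewrite fk|case: (f j)].
  case: (f i) => [v|] //=; rewrite /bump !leq0n !add1n !ltnS; congr (_ && _).
  by case: (f j).
- by move=> i; rewrite /lower; case: (extend f a b (lift ord0 i)) => // v; rewrite ltn0.
- by move=> k; rewrite /lower; case: (extend _ _ _ _) => // v; rewrite ltn0 andbF.
Qed.

Lemma cro_partial_extend {n} (f : partial_map n) a b : extendable f a b ->
  cro_partial (extend f a b) = (cro_partial f
    + (if obind (unlift ord0) a is Some v then
         (b == None) + #|[set u in open_val f | (u < v)%N]| else 0)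
    + (if b is Some i then #|[set j in open_pos f | (j < i)%N]| else 0))%N.
Proof.
move=> ab; have [USS US0 U00 U0S] := upper_extend f a b ab.
have [LSS LS0 L0] := lower_extend f a b ab.
(* Both double sums are split into the part of the new letters (index 0) and the
   part of the old ones (successor indices). *)
rewrite /cro_partial [in LHS]big_ord_recl [in LHS]big_ord_recl U00.
under eq_bigr do rewrite U0S.
under [X in (_ + _ + X + _)%N]eq_bigr => j _.
  rewrite big_ord_recl US0 add0n.
  under eq_bigr do rewrite USS.
  over.
rewrite [X in (_ + X)%N]big_ord_recl [X in (_ + (X + _))%N]big1 => [|k _]; last by rewrite L0.
under [X in (_ + (_ + X))%N]eq_bigr => i _.
  rewrite big_ord_recl LS0 !add0n.
  under eq_bigr => j _.
    rewrite LSS (_ : nat_of_bool _ =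
      (lower f i j + [&& b == Some i, j \in open_pos f & (j < i)%N])%N).
      over.
    case: (b =P Some i) ab => [->|_ _]; last by rewrite orbF addn0.
    by case/andP; rewrite inE /lower => /eqP ->.
  rewrite big_split /=.
  over.
rewrite big_split /= !sum_nat_of_bool add0n.
set A := (\sum_i \sum_i0 upper f i i0)%N.
set B := (\sum_(i < n) \sum_(i0 < n) lower f i i0)%N.
set X := (_ + #|_|)%N; set Y := (\sum_(i < n) _)%N.
set X' := (if obind _ _ is Some _ then _ else _); set Y' := (if b is Some _ then _ else _).
have -> : X = X'.
  rewrite /X /X'; case: a ab {USS US0 U00 U0S LSS LS0 L0 X X'} => [v|] ab /=; last first.
    by rewrite andbF add0n -[RHS](cards0 'I_n); apply: eq_card => u; rewrite !inE andbF.
  case: (unliftP ord0 v) => [v'|] -> /=.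
    by rewrite andbT; congr (_ + _)%N; apply: eq_card => u; rewrite !inE.
  by rewrite andbF add0n -[RHS](cards0 'I_n); apply: eq_card => u; rewrite !inE andbF.
have -> : Y = Y'.
  rewrite /Y /Y'; case: b {ab USS US0 U00 U0S LSS LS0 L0 X X' Y Y'} => [k|].
    rewrite (bigD1 k) //= [X in (_ + X)%N]big1 ?addn0 => [|i /negbTE ik].
      by rewrite sum_nat_of_bool eqxx; apply: eq_card => j; rewrite !inE.
    by rewrite big1 // => j _; rewrite (inj_eq (@Some_inj _)) eq_sym ik.
  by rewrite big1 // => i _; rewrite big1.
lia.
Qed.

(** * The q-derivative *)

Lemma coef_qderiv f k : (qderiv f)`_k = qint k.+1 * f`_k.+1.
Proof.
rewrite coef_poly; case: ltnP => // fk.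
by rewrite [f`__]nth_default ?mulr0 //; move: fk; case: (size f).
Qed.

Lemma qderivD f g : qderiv (f + g) = qderiv f + qderiv g.
Proof. by apply/polyP=> k; rewrite coefD !coef_qderiv coefD mulrDr. Qed.

Lemma qderivCM c f : qderiv (c%:P * f) = c%:P * qderiv f.
Proof. by apply/polyP=> k; rewrite coefCM !coef_qderiv coefCM mulrCA. Qed.

Lemma qderiv0 : qderiv 0 = 0.
Proof. by apply/polyP=> k; rewrite coef_qderiv !coef0 mulr0. Qed.

Lemma qderiv_sum (I : finType) (P : pred I) (F : I -> tq_poly) :
  qderiv (\sum_(i | P i) F i) = \sum_(i | P i) qderiv (F i).
Proof. by apply: (big_morph qderiv qderivD qderiv0). Qed.

Lemma qintS n : qint n.+1 = 1 + 'X * qint n.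
Proof.
rewrite /qint big_ord_recl expr0 mulr_sumr; congr (_ + _).
by apply: eq_bigr => i _; rewrite -exprS.
Qed.

(** * The recurrence for partial injections *)

(** The q-factorial stands for the ways to turn the open letters into negative
    ones. *)
Definition pinj_weight (x : {poly int}) {n} (f : partial_map n) : tq_poly :=
  (x ^+ weak_exc f * 'X^(cro_partial f) * qfact #|open_pos f|)%:P * t ^+ #|open_pos f|.

(** In the basis e_h = [h]! t^h the operator g |-> D ((t + 1) g) sends e_h to
    [h+1] e_h + [h]^2 e_(h-1). As [h+1] t e_h = e_(h+1), multiplying by t + x gives the weights 1, [h] + x [h+1]
    and x [h]^2 of the insertions that increase, keep and decrease the number of
    open letters. *)
Lemma qderiv_shift h :
  (qfact h)%:P * qderiv ((t + 1) * t ^+ h)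
  = (qfact h.+1)%:P * t ^+ h + (qfact h.-1 * (qint h) ^+ 2)%:P * t ^+ h.-1.
Proof.
rewrite mulrDl mul1r -exprS qderivD !qderivXn /= mulrDr !mulrA -!polyCM -qfactS.
congr (_ + _%:P * _); case: h => [|h]; last by rewrite qfactS.
by rewrite /qint big_ord0 !mulr0.
Qed.

(** With h open positions and values in [f] and [W] its weight without [h]!, the new
    letters contribute, in the order of the proof: [h+1]! t^(h+1) if both stay open;
    [h] [h]! t^h if only an open position is closed; x [h]! t^h if they are matched
    together; and, if an open value is closed, x q [h] [h]! t^h or x [h]^2 [h-1]!
    t^(h-1) according to whether the new value stays open (it then adds a crossing) or
    closes a position. By 1 + q [h] = [h+1] these add up to the operator. *)
Lemma sum_pinj_weight_extend x {n} (f : partial_map n) : pinj f ->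
  \sum_(a : option 'I_n.+1) \sum_(b : option 'I_n | extendable f a b)
     pinj_weight x (extend f a b)
  = (t + x%:P) * qderiv ((t + 1) * pinj_weight x f).
Proof.
move=> f_inj; set h := #|open_pos f|.
pose W := x ^+ weak_exc f * 'X^(cro_partial f).
(* k and e are the numbers of new crossings on the upper and on the lower side. *)
have WE a b k e h' : extendable f a b ->
    (if obind (unlift ord0) a is Some v then
         (b == None) + #|[set u in open_val f | (u < v)%N]| else 0)%N = k ->
    (if b is Some i then #|[set j in open_pos f | (j < i)%N]| else 0)%N = e ->
    (h' + (b != None) = h + (a == None))%N ->
  pinj_weight x (extend f a b)
    = W%:P * (x ^+ (a != None) * 'X^k * 'X^e)%:P * ((qfact h')%:P * t ^+ h').
  move=> ab kE eE hE; rewrite /pinj_weight weak_exc_extend // cro_partial_extend // kE eE.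
  have -> : #|open_pos (extend f a b)| = h'.
    by have := card_open_extend f a b ab; rewrite -/h -hE => /addIn.
  rewrite /W; move: (cro_partial f) (weak_exc f) => c w.
  by rewrite !exprD !mulrA -!polyCM; congr (_%:P * _); ring.
have sumP : \sum_(i in open_pos f) ('X^(#|[set j in open_pos f | (j < i)%N]|))%:P
    = (qint h)%:P :> tq_poly.
  by rewrite -(big_morph polyC (@polyCD _) (@polyC0 _)) sum_Xn_rank.
have sumV : \sum_(v in open_val f) ('X^(#|[set u in open_val f | (u < v)%N]|))%:P
    = (qint h)%:P :> tq_poly.
  by rewrite -(big_morph polyC (@polyCD _) (@polyC0 _)) sum_Xn_rank card_open_val.
have sumN : \sum_(b | extendable f None b) pinj_weight x (extend f None b)
  = W%:P * ((qfact h.+1)%:P * t ^+ h.+1 + (qint h)%:P * ((qfact h)%:P * t ^+ h)).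
  rewrite big_option mulrDr; congr (_ + _).
    rewrite /extendable /= (WE _ _ 0 0 h.+1)%N //; last by rewrite /=; lia.
    by rewrite !expr0 !mulr1.
  rewrite -sumP mulr_suml mulr_sumr; apply: eq_big => [i|i iP].
    by rewrite /extendable andbT.
  by rewrite (WE _ _ 0%N _ h _ _ erefl) //= ?expr0 ?mul1r ?mulrA.
have sum0 : \sum_(b | extendable f (Some ord0) b) pinj_weight x (extend f (Some ord0) b)
  = W%:P * x%:P * ((qfact h)%:P * t ^+ h).
  rewrite big_option [X in _ + X]big1 => [|i].
    rewrite addr0 /extendable /= unlift_none /= (WE _ _ 0 0 h)%N //=.
    - by rewrite expr1 !expr0 !mulr1.
    - by rewrite /extendable unlift_none.
    - by rewrite unlift_none.
  by rewrite /extendable unlift_none andbF.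
have sumS v : v \in open_val f ->
  \sum_(b | extendable f (Some (lift ord0 v)) b) pinj_weight x (extend f (Some (lift ord0 v)) b)
  = W%:P * x%:P * ('X^(#|[set u in open_val f | (u < v)%N]|))%:P *
      ('X%:P * ((qfact h)%:P * t ^+ h) + (qint h)%:P * ((qfact h.-1)%:P * t ^+ h.-1)).
  move=> vV; rewrite big_option mulrDr; congr (_ + _).
    have ext : extendable f (Some (lift ord0 v)) None by rewrite /extendable liftK.
    rewrite ext (WE _ _ (1 + #|[set u in open_val f | (u < v)%N]|) 0 h)%N //=.
      by rewrite exprD expr0 !mulr1 !expr1 !polyCM !mulrA; ring.
    by rewrite liftK.
  rewrite -sumP mulr_suml mulr_sumr; apply: eq_big => [i|i iP].
    by rewrite /extendable liftK vV andbT.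
  rewrite (WE _ _ #|[set u in open_val f | (u < v)%N]| _ h.-1 _ _ erefl) //=.
  - by rewrite expr1 !polyCM !mulrA.
  - by rewrite liftK.
  - move: iP; rewrite /extendable liftK vV andbT /h => iP.
    by rewrite (cardD1 i) iP /=; lia.
rewrite big_option /= sumN big_ord_recl sum0.
rewrite (bigID (mem (open_val f))) /= [X in _ + (_ + (_ + X))]big1 => [|v vV]; last first.
  by apply: big1 => b; rewrite /extendable liftK (negbTE vV) andbF.
rewrite addr0 (eq_bigr _ sumS) -mulr_suml -mulr_sumr sumV.
have -> : pinj_weight x f = W%:P * ((qfact h)%:P * t ^+ h) by rewrite /pinj_weight polyCM mulrA.
rewrite [(t + 1) * _]mulrCA qderivCM [(t + 1) * _]mulrCA qderivCM qderiv_shift qfactS.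
have -> : qint h.+1 = 1 + 'X * qint h := qintS h.
rewrite !polyCM !polyCD !polyCM exprS.
(* For h = 0 the terms with h.-1 are meaningless, but they have the factor [0]. *)
case: {WE sumP sumV sumN sum0 sumS} h => [|h] /=.
  by rewrite /qint !big_ord0 !polyC0; ring.
by rewrite qfactS exprS !polyCM; ring.
Qed.

Definition pinj_sum (x : {poly int}) n : tq_poly :=
  \sum_(f : partial_map n | pinj f) pinj_weight x f.

Lemma pinj_sum0 x : pinj_sum x 0 = 1.
Proof.
rewrite /pinj_sum (big_pred1 [ffun=> None]) => [|f].
  rewrite /pinj_weight /weak_exc /cro_partial !big_ord0 !expr0.
  have -> : #|open_pos ([ffun=> None] : partial_map 0)| = 0%N by apply: eq_card0 => -[].
  by rewrite /qfact big_ord0 !expr0 !mulr1.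
rewrite /= [RHS](_ : _ = true); first by apply/pinjP=> -[].
by apply/eqP/ffunP=> -[].
Qed.

Lemma pinj_sumS x n :
  pinj_sum x n.+1 = (t + x%:P) * qderiv ((t + 1) * pinj_sum x n).
Proof.
rewrite /pinj_sum mulr_sumr qderiv_sum mulr_sumr.
rewrite (reindex_onto (fun r => extend r.1.1 r.1.2 r.2) restrict) => [|f]; last first.
  exact: restrictK.
under [RHS]eq_bigr => f f_inj do
  rewrite -sum_pinj_weight_extend // (pair_big_dep predT (extendable f)
    (fun a b => pinj_weight x (extend f a b))) /=.
rewrite pair_big_dep /=.
rewrite (reindex (fun r : partial_map n * (option 'I_n.+1 * option 'I_n) =>
  (r.1, r.2.1, r.2.2))) /=.
  by apply: eq_bigl => -[f [a b]]; exact: pinj_extend.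
by exists (fun r => (r.1.1, (r.1.2, r.2))) => [[? []]|[[]]].
Qed.

(** * From signed permutations to partial injections *)

Definition signed_fun {n} (p : 'S_n) (e : {ffun 'I_n -> bool}) (x : letter n) : letter n :=
  (p x.1, x.2 (+) e x.1).

Lemma signed_fun_inj {n} (p : 'S_n) e : injective (signed_fun p e).
Proof. by move=> [i b] [j c] [/perm_inj -> /addIb ->]. Qed.

Definition signed_perm {n} (p : 'S_n) e : {perm letter n} := perm (@signed_fun_inj n p e).

(** A signed permutation amounts to the permutation of its absolute values together
    with the set of its negative positions. *)
Lemma sum_signed_perms (R : nmodType) n (F : {perm letter n} -> R) :
  \sum_(s in signed_perms n) F s
  = \sum_(r : 'S_n * {ffun 'I_n -> bool}) F (signed_perm r.1 r.2).
Proof.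
pose h (r : 'S_n * {ffun 'I_n -> bool}) := signed_perm r.1 r.2.
rewrite (_ : signed_perms n = h @: setT); last first.
  apply/setP=> s; rewrite inE; apply/forallP/imsetP => [sN|[[p e] _ ->] [i b]]; last first.
    by rewrite /h /= !permE /signed_fun /letter_opp /= addNb.
  have sE i b : s (i, b) = ((s (i, false)).1, b (+) (s (i, false)).2).
    case: b; last by rewrite addFb -surjective_pairing.
    by have /eqP := sN (i, false); rewrite /letter_opp /= => ->.
  have p_inj : injective (fun i => (s (i, false)).1).
    move=> i j sij; have := sE i ((s (j, false)).2 (+) (s (i, false)).2).
    by rewrite -addbA addbb addbF sij -surjective_pairing => /perm_inj [].
  exists (perm p_inj, [ffun i => (s (i, false)).2]) => //.
  by apply/permP=> -[i b]; rewrite /h permE /signed_fun /= permE ffunE sE.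
rewrite big_imset /=; first by apply: eq_bigl => r; rewrite inE.
move=> [p e] [p' e'] _ _ /permP hr; congr (_, _).
  by apply/permP=> i; have := hr (i, false); rewrite !permE => -[].
by apply/ffunP=> i; have := hr (i, false); rewrite !permE => -[].
Qed.

Definition pos_part {n} (p : 'S_n) (e : {ffun 'I_n -> bool}) : partial_map n :=
  [ffun i => if e i then None else Some (p i)].

Lemma window_signed_perm {n} (p : 'S_n) e i :
  window (signed_perm p e) i = if e i then - (p i).+1%:Z else (p i).+1%:Z.
Proof. by rewrite /window permE. Qed.

Lemma pinj_pos_part {n} (p : 'S_n) e : pinj (pos_part p e).
Proof.
apply/pinjP=> i j v; rewrite !ffunE; case: (e i) => // -[<-]; case: (e j) => // -[].
by move/perm_inj.
Qed.

Lemma neg_signed_perm {n} (p : 'S_n) e :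
  neg (signed_perm p e) = #|open_pos (pos_part p e)|.
Proof.
by apply: eq_card => i; rewrite !inE window_signed_perm ffunE; case: (e i).
Qed.

Lemma wex_signed_perm {n} (p : 'S_n) e :
  wex (signed_perm p e) = weak_exc (pos_part p e).
Proof.
rewrite /wex -sum_nat_of_bool; apply: eq_bigr => i _.
by rewrite window_signed_perm ffunE /position /letter_val /=; case: (e i).
Qed.

(** Of the three kinds of crossings, the first two, where the second letter is a
    positive weak excedance, are the upper ones. The third kind is a lower crossing
    when the first letter is positive, and an inversion of absolute values when both
    are negative. *)
Lemma croB_signed_perm {n} (p : 'S_n) e :
  croB (signed_perm p e)
  = (cro_partial (pos_part p e) + inv_on (open_pos (pos_part p e)) p)%N.
Proof.
have cardE (P : rel 'I_n) : (#|[set x | P x.1 x.2]| = \sum_i \sum_j P i j)%N.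
  by rewrite pair_bigA sum_nat_of_bool.
set P := open_pos _; rewrite /croB (cardE (crossing _)) /cro_partial /inv_on.
rewrite (cardE (fun i j => [&& i \in P, j \in P, (j < i)%N & (p i < p j)%N])) {}/P.
(* A value u is indexed by the position i with |s(i)| = u. *)
have -> : (\sum_j \sum_u upper (pos_part p e) j u
           = \sum_i \sum_j upper (pos_part p e) j (p i))%N.
  rewrite exchange_big /=; apply: (reindex_inj (@perm_inj _ p)).
rewrite -!big_split; apply: eq_bigr => i _; rewrite -!big_split; apply: eq_bigr => j _ /=.
rewrite /crossing !window_signed_perm /position /letter_val /upper /lower !inE !ffunE /=.
(* The value p i is taken by a positive letter at the right of j unless i is
   negative or i <= j. *)
have -> : [forall k : 'I_n, (j < k)%N ==> (pos_part p e k != Some (p i))]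
          = e i || (i <= j)%N.
  apply/forallP/idP => [/(_ i)|ij k].
    by rewrite ffunE; case: (e i) => //=; rewrite eqxx; lia.
  apply/implyP=> jk; rewrite ffunE; case: ifP => // ek; apply/eqP=> /Some_inj/perm_inj ki.
  by move: ij jk; rewrite -ki ek /=; lia.
case: (i =P j) => [->|/eqP]; last rewrite -val_eqE /= => ij.
  by case: (e j); lia.
by case: (e i); case: (e j) => /=; lia.
Qed.

(** Grouping the signed permutations by their positive part: the signs can be read
    off [f], and the permutations with positive part [f] are its completions. *)
Lemma sum_signed_pos_part n (F : partial_map n -> tq_poly) :
  \sum_(r : 'S_n * {ffun 'I_n -> bool})
     F (pos_part r.1 r.2) * ('X^(inv_on (open_pos (pos_part r.1 r.2)) r.1))%:P
  = \sum_(f : partial_map n | pinj f) F f * (qfact #|open_pos f|)%:P.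
Proof.
rewrite (partition_big (fun r => pos_part r.1 r.2) (@pinj n)) /= => [|r _]; last first.
  exact: pinj_pos_part.
apply: eq_bigr => f /pinjP f_inj.
under eq_bigr => r /eqP -> do [].
rewrite -mulr_sumr; congr (_ * _).
rewrite -(@sum_Xn_inv_on _ (open_pos f) (fun i => odflt i (f i))); last first.
  move=> i j; rewrite !inE; case fi: (f i) => [v|//] _.
  by case fj: (f j) => [w|//] _ /= vw; apply: f_inj fi _; rewrite fj vw.
rewrite (big_morph polyC (@polyCD _) (@polyC0 _)).
rewrite (reindex_onto (fun p : 'S_n => (p, [ffun i => f i == None])) fst) /= => [|[p e] /eqP <-].
  apply: eq_bigl => p; rewrite eqxx andbT; apply/eqP/forall_inP => [fE i|fE].
    by rewrite !inE -fE !ffunE; case: (f i) => //= v; rewrite eqxx.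
  apply/ffunP=> i; rewrite !ffunE; case fi: (f i) => [v|] //=.
  by have := fE i; rewrite !inE fi => /(_ isT) /eqP ->.
by congr (_, _); apply/ffunP=> i; rewrite !ffunE; case: (e i).
Qed.

(** The factor [c] of the number of negative entries is arbitrary, so that the sign
    (-1)^floor(neg/2) and the restriction to even signed permutations fit in. *)
Lemma sum_signed_weight n (x : {poly int}) (c : nat -> tq_poly) :
  \sum_(s in signed_perms n)
    (x ^+ wex s * 'X^(croB s))%:P * c (neg s)
  = \sum_(f : partial_map n | pinj f)
      (x ^+ weak_exc f * 'X^(cro_partial f) * qfact #|open_pos f|)%:P * c #|open_pos f|.
Proof.
rewrite sum_signed_perms.
pose F (f : partial_map n) := (x ^+ weak_exc f * 'X^(cro_partial f))%:P * c #|open_pos f|.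
transitivity (\sum_(f : partial_map n | pinj f) F f * (qfact #|open_pos f|)%:P).
  rewrite -sum_signed_pos_part; apply: eq_bigr => r _.
  rewrite wex_signed_perm neg_signed_perm croB_signed_perm exprD /F.
  by rewrite mulrA [in LHS]polyCM -!mulrA; congr (_ * _); rewrite mulrC.
by apply: eq_bigr => f _; rewrite /F mulrAC -polyCM.
Qed.

(** * The specialization x = -1 *)

Definition altRpoly (m : nat) : tq_poly :=
  iter m (fun f => qderiv ((t + 1) * ((t - 1) * f))) 1.

(** The iterates of (t - 1) D (t + 1) regrouped as iterates of D (t + 1) (t - 1). *)
Lemma pinj_sum_altRpoly m : pinj_sum (-1) m.+1 = (t - 1) * altRpoly m.
Proof.
elim: m => [|m IHm]; rewrite pinj_sumS.
  rewrite pinj_sum0 mulr1 qderivD -[X in qderiv X + _]expr1 qderivXn.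
  have -> : qderiv 1 = 0 by rewrite -(expr0 t) qderivXn /qint big_ord0 mul0r.
  by rewrite /qint big_ord1 !expr0 mulr1 addr0 polyCN.
by rewrite IHm polyCN /altRpoly iterS.
Qed.

Lemma coef_altRpolyS m k : (altRpoly m.+1)`_k =
  qint k.+1 * ((if k is k'.+1 then (altRpoly m)`_k' else 0) - (altRpoly m)`_k.+1).
Proof.
rewrite /altRpoly iterS coef_qderiv -/(altRpoly m); congr (_ * _).
rewrite (_ : _ * _ = t * (t * altRpoly m) - altRpoly m); last by ring.
by rewrite coefB /t !coefXM; case: k.
Qed.

Lemma coef_RpolyS m k : (Rpoly m.+1)`_k =
  qint k.+1 * ((if k is k'.+1 then (Rpoly m)`_k' else 0) + (Rpoly m)`_k.+1).
Proof.
rewrite /Rpoly iterS -/(Rpoly m) coefD !coef_qderiv -mulrDr addrC.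
by rewrite /mult /t !coefXM; case: k.
Qed.

Lemma coef_Rpoly_odd m k : odd (m + k) -> (Rpoly m)`_k = 0.
Proof.
elim: m k => [|m IHm] k mk; first by rewrite coef1; case: k mk.
rewrite coef_RpolyS IHm; last by move: mk; lia.
by case: k mk => [|k] mk; rewrite ?IHm ?addr0 ?mulr0 //; move: mk; lia.
Qed.

(** This is the substitution of i t for t (i^2 = -1), which turns D t^2 - D into
    i (D t^2 + D): it multiplies the coefficient of t^k by i^(m - k) =
    (-1)^((m - k)/2), and (m - k)/2 has the parity of (m + k)/2 + k when m + k is
    even. All other coefficients vanish. *)
Lemma coef_altRpoly m k : (altRpoly m)`_k = (-1) ^+ ((m + k)./2 + k) * (Rpoly m)`_k.
Proof.
have [mk|mk] := boolP (odd (m + k)).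
  rewrite (coef_Rpoly_odd m k mk) mulr0.
  elim: m k mk => [|m IHm] k mk; first by rewrite coef1; case: k mk.
  rewrite coef_altRpolyS IHm; last by move: mk; lia.
  by case: k mk => [|k] mk; rewrite ?IHm ?subr0 ?mulr0 //; move: mk; lia.
elim: m k mk => [|m IHm] k mk.
  by rewrite !coef1; case: k mk => [|k] _; rewrite ?mulr0 ?expr0 ?mul1r.
rewrite coef_altRpolyS coef_RpolyS mulrCA; congr (_ * _).
rewrite mulrDr IHm; last by move: mk; lia.
congr (_ + _).
  case: k mk => [|k] mk; first by rewrite mulr0.
  rewrite IHm; last by move: mk; lia.
  congr (_ * _); rewrite -signr_odd -[RHS]signr_odd; congr (_ ^+ nat_of_bool _).
  by rewrite addSnnS; lia.
rewrite -mulNr; congr (_ * _); rewrite -[in LHS]mulN1r -exprS.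
rewrite -signr_odd -[RHS]signr_odd; congr (_ ^+ nat_of_bool _).
by move: mk; lia.
Qed.

Lemma polyC_sign m : ((-1) ^+ m)%:P = (-1) ^+ m :> tq_poly.
Proof. by rewrite rmorphXn rmorphN1. Qed.

(** The floor of fwex/2 is wex + floor(neg/2): the first summand gives x = -1, the
    second a sign that depends on the power of t only. *)
Lemma coef_signed_sum n (P : pred nat) k :
  (\sum_(s in signed_perms n | P (neg s))
     (-1) ^+ (fwex s)./2 * t ^+ neg s * q ^+ croB s)`_k
  = if P k then (-1) ^+ k./2 * (pinj_sum (-1) n)`_k else 0.
Proof.
pose c h : tq_poly := if P h then (-1) ^+ h./2 * t ^+ h else 0.
rewrite -[LHS]/(coefp k _); transitivity (coefp k (\sum_(s in signed_perms n)
    ((-1) ^+ wex s * 'X^(croB s))%:P * c (neg s))).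
  congr (coefp k _); rewrite big_mkcondr; apply: eq_bigr => s _; rewrite /c.
  case: ifP => _; last by rewrite mulr0.
  rewrite /fwex mul2n halfD odd_double doubleK add0n exprD polyCM !rmorphXn /= rmorphN1.
  rewrite /q; ring.
rewrite sum_signed_weight /= /pinj_sum !coef_sum; case: ifP => Pk.
  rewrite mulr_sumr; apply: eq_bigr => f _; rewrite /pinj_weight !coefCM /c mulrCA; congr (_ * _).
  rewrite /t; case: ifP => [_|nP].
    rewrite -polyC_sign coefCM coefXn; case: eqP => [->//|_]; by rewrite !mulr0.
  by rewrite coef0 coefXn; case: eqP => [E|_]; [rewrite -E Pk in nP|rewrite mulr0].
apply: big1 => f _; rewrite coefCM /c; case: ifP => [Pf|_]; last by rewrite coef0 mulr0.
rewrite -polyC_sign coefCM coefXn.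
by case: eqP => [E|_]; [rewrite -E Pk in Pf|rewrite !mulr0].
Qed.

(** Both [Rpoly m] and its multiple by t have coefficients in one parity class only,
    and the two classes are complementary. On each of them the sign of
    [coef_altRpoly] times (-1)^floor(k/2) no longer depends on k. *)
Lemma coef_pinj_sum_Rpoly m k :
  (-1) ^+ k./2 * (pinj_sum (-1) m.+1)`_k
  = (((-1) ^+ m.+2./2 + (-1) ^+ m.+1./2 * t) * Rpoly m)`_k.
Proof.
rewrite pinj_sum_altRpoly mulrBl mul1r coefB /t coefXM mulrDl coefD -mulrA.
rewrite -!polyC_sign !coefCM coefXM !coef_altRpoly mulrDr addrC.
congr (_ + _).
  rewrite mulrN mulrA -mulNr.
  have [mk|mk] := boolP (odd (m + k)); first by rewrite coef_Rpoly_odd // !mulr0.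
  congr (_ * _); rewrite -exprD -[in LHS]mulN1r -exprS -signr_odd -[RHS]signr_odd.
  by congr (_ ^+ nat_of_bool _); move: mk; lia.
case: k => [|k] /=; first by rewrite !mulr0.
rewrite mulrA.
have [mk|mk] := boolP (odd (m + k)); first by rewrite coef_Rpoly_odd // !mulr0.
congr (_ * _); rewrite -exprD -signr_odd -[RHS]signr_odd.
by congr (_ ^+ nat_of_bool _); move: mk; lia.
Qed.

Theorem theorem1p3 (n : nat) (hn : (1 <= n)%N) :
  \sum_(s in signed_perms n) (-1) ^+ (fwex s)./2 * t ^+ neg s * q ^+ croB s
    = ((-1) ^+ (n + 1)./2 + (-1) ^+ n./2 * t) * Rpoly (n - 1)
  /\
  \sum_(s in even_signed_perms n) (-1) ^+ (fwex s)./2 * t ^+ neg s * q ^+ croB s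
    = (if odd n then (-1) ^+ (n + 1)./2 * Rpoly (n - 1)
       else (-1) ^+ n./2 * t * Rpoly (n - 1)).
Proof.
case: n hn => // m _; rewrite addn1 subn1 /=.
split; apply/polyP=> k.
  rewrite -coef_pinj_sum_Rpoly; have /= <- := coef_signed_sum m.+1 predT k.
  by congr (coefp k _); apply: eq_bigl => s; rewrite andbT.
transitivity (if ~~ odd k then (-1) ^+ k./2 * (pinj_sum (-1) m.+1)`_k else 0).
  rewrite -(coef_signed_sum m.+1 (fun h => ~~ odd h) k).
  by congr (coefp k _); apply: eq_bigl => s; rewrite inE.
rewrite coef_pinj_sum_Rpoly mulrDl coefD -!mulrA /t.
rewrite (fun_if (fun f : tq_poly => f`_k)) -!polyC_sign !coefCM !coefXM.
(* For even k one of the two products vanishes, according to the parity of m; for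
   odd k the product in the right-hand side does. *)
have R0 := coef_Rpoly_odd m k.
case: (boolP (odd m)) => mo /=; case: (boolP (odd k)) => ko /=.
- case: k ko {R0} => // k ko; rewrite coef_Rpoly_odd ?mulr0 //; move: mo ko => /=; lia.
- by rewrite R0 ?mulr0 ?add0r //; lia.
- by rewrite R0 ?mulr0 //; lia.
- case: k ko {R0} => [|k] ko /=; first by rewrite mulr0 addr0.
  by rewrite [(Rpoly m)`_k]coef_Rpoly_odd ?mulr0 ?addr0 //; move: mo ko => /=; lia.
Qed.
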